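(* (1) For every prime $r$, the polynomials $\Psi_{15r}(x)$ and $\Psi_{21r}(x)$ are flat. (2) Let $q\ge 11$ be a prime. Then $\Psi_{3qr}(x)$ is flat for all primes $r\ge 2q-1$; however, there is at least one prime $r$ such that $\Psi_{3qr}(x)$ is not flat. (3) Let $3<q<r$ be primes. Then for all $k\le 16$ the coefficient $c_{3qr}(k)$ of $x^k$ in $\Psi_{3qr}(x)$ satisfies $|c_{3qr}(k)|\le 1$.
   Context: $\Phi_n(x)$ is the $n$-th cyclotomic polynomial and $\Psi_n(x)=(x^n-1)/\Phi_n(x)=\sum_k c_n(k)x^k\in\mathbb Z[x]$ (with $c_n(k)=0$ for $k$ outside $[0,n-\varphi(n)]$). A polynomial in $\mathbb Z[x]$ is flat if the maximum absolute value of its coefficients equals $1$. *)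

(* Defs.v *)
From HB Require Import structures.
From mathcomp Require Import all_boot all_order all_algebra all_field.
Set Implicit Arguments.
Unset Strict Implicit.
Unset Printing Implicit Defensive.
Import Order.TTheory GRing.Theory Num.Theory.
Local Open Scope ring_scope.

(* 'Phi_n is monic, so %/ is Euclidean division in Z[x]; it is exact for       *)
(* n > 0 by invCyclotomicK below.                                              *)
Definition invCyclotomic (n : nat) : {poly int} := ('X^n - 1) %/ 'Phi_n.

Notation "''Psi_' n" := (invCyclotomic n)
  (at level 8, n at level 2, format "''Psi_' n") : ring_scope.

Definition height (p : {poly int}) : nat := (\max_(i < size p) absz (p`_i)%R)%N.

Definition flat (p : {poly int}) : Prop := height p = 1%N.

Lemma invCyclotomicK n : (0 < n)%N -> 'Psi_n * 'Phi_n = 'X^n - 1.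
Proof.
move=> n_gt0; rewrite /invCyclotomic -prod_Cyclotomic //.
rewrite (big_rem n) -?dvdn_divisors //= ['Phi_n * _]mulrC.
by rewrite Pdiv.IdomainMonic.mulpK ?Cyclotomic_monic.
Qed.

(* Main.v *)
Require Import Defs.
From mathcomp Require Import all_boot all_order all_algebra all_field.
From mathcomp Require Import zify ring.

(* Since 'Phi_n(x^r) = 'Phi_nr(x) 'Phi_n(x) for a prime r not dividing n, one  *)
(* has 'Psi_3qr(x) = 'Phi_3q(x) (x^qr - 1) (1 + x^r + x^2r): the coefficients  *)
(* are signed sums of six shifted copies of those of 'Phi_3q, which are -1, 0  *)
(* or 1 and explicit in terms of residues mod 3. The copies are disjoint when  *)
(* r >= 2q - 1, as 'Phi_3q has degree 2q - 2; when q < r <= 2q - 3 and         *)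
(* r = q mod 3, two neighbouring copies have a common non-zero value at some   *)
(* degree where they overlap, so a coefficient 2 or -2 appears.                *)
(* Non-flatness thus rests on a Bertrand postulate in the residue classes      *)
(* mod 3. In the manner of Erdos, compare the product N of the m <= 6s with    *)
(* m = a mod 3 to the product D of the m <= 3s prime to 3: N / D is at least   *)
(* 4^s / 2s, while a prime dividing N more often than D is at most sqrt(6s),   *)
(* at most 6s/7, or congruent to a and in ]3s, 6s]; those of the first two     *)
(* kinds contribute at most (6s)^sqrt(6s) 4^(6s/7). For s = floor(q/3) this    *)
(* leaves room for a prime r != q of the third kind.                           *)

Set Implicit Arguments.
Unset Strict Implicit.
Unset Printing Implicit Defensive.

(** * Primes congruent to a mod 3 between 3s and 6s *)

(** Everything reduces to the closed form [Psi3qr_coef], which comes from the substitution identity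
    [Cyclotomic_comp_Xn] and from the recurrence that 'Phi_3 imposes on the coefficients of 'Phi_3q
    ([coef_Cyclotomic3q]). For r >= 2q - 1 the six copies have disjoint supports ([Psi3qr_coef_le]).
    For q = 5 and q = 7 this leaves finitely many primes r, settled by computation, and the r
    dividing 3q, where 'Psi_3qr is 'Psi_3q(x^r), six signed monomials of distinct degrees. In (3), a
    degree k <= 16 < r meets only the copy -'Phi_3q; the pairs with r < 17 are computed. For
    non-flatness, [prime_class_next] provides r = q mod 3 with q < r <= 2q - 3, and
    [not_flat_invCyclotomic3qr] exhibits the coefficient 2 or -2. Below 72600 such an r is found in
    explicit chains of primes, beyond by [prime_class_other]. *)

Lemma prod_primes_dvd (r : seq nat) (P : pred nat) (c : nat) :
  uniq r -> {in r, forall p, P p -> prime p && (p %| c)} ->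
  \prod_(p <- r | P p) p %| c.
Proof.
elim: r => [|p r IHr] /=; first by rewrite big_nil dvd1n.
case/andP=> p_notin r_uniq Hr; rewrite big_cons.
have {}IHr : \prod_(j <- r | P j) j %| c.
  by apply: IHr => // j j_r; apply: Hr; rewrite inE j_r orbT.
have [Pp|//] := ifP; have /andP[p_prime p_c] := Hr p (mem_head _ _) Pp.
rewrite Gauss_dvd ?p_c // prime_coprime // Euclid_dvd_prod // big_has_cond.
apply/hasPn=> j j_r; apply/negP=> /andP[Pj].
have /andP[j_prime _] := Hr j (predU1r _ _ j_r) Pj.
by rewrite dvdn_prime2 // => /eqP eq_pj; rewrite eq_pj j_r in p_notin.
Qed.

(** * Chebyshev's bound on the product of the primes up to n *)

Lemma bin_half_le m : 'C(m.*2.+1, m) <= 4 ^ m.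
Proof.
have: 'C(m.*2.+1, m) + 'C(m.*2.+1, m.+1) <= 2 ^ m.*2.+1.
  rewrite -[2]/(1 + 1) expnDn.
  have lt1 : m < m.*2.+2 by lia.
  have lt2 : m.+1 < m.*2.+2 by lia.
  rewrite (bigD1 (Ordinal lt1)) //= (bigD1 (Ordinal lt2)) /=; last first.
    by apply/eqP=> /(congr1 val) /=; lia.
  by rewrite !exp1n !muln1 addnA leq_addr.
have -> : 'C(m.*2.+1, m.+1) = 'C(m.*2.+1, m).
  rewrite -(@bin_sub m.*2.+1 m); last by lia.
  by congr 'C(_, _); lia.
by rewrite addnn -muln2 expnS -mul2n expnM mulnC leq_pmul2l.
Qed.

(** Strong induction: an even n > 2 adds no prime, and for n = 2m + 1 the primes in ]m + 1, 2m + 1]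
    all divide the binomial of [bin_half_le]. *)
Lemma primorial_le n : \prod_(1 <= p < n.+1 | prime p) p <= 4 ^ n.
Proof.
have [k] := ubnP n; elim: k n => // k IHk [|[|n]] lt_nk.
- by rewrite big_geq.
- by rewrite unlock.
have [n0|n_gt0] := posnP n; first by rewrite n0 unlock.
have [odd_n|even_n] := boolP (odd n); last first.
  rewrite big_mkcond big_nat_recr //= -big_mkcond.
  have -> : prime n.+2 = false.
    by apply/negP=> /even_prime; rewrite /= negbK (negPf even_n); lia.
  by rewrite muln1 (leq_trans (IHk n.+1 _)) ?leq_exp2l //; lia.
pose m := (n.+1)./2.
have def_n : n.+2 = m.*2.+1 by rewrite /m; lia.
rewrite def_n (@big_cat_nat _ _ _ m.+2) /=; [|lia|lia].
apply: (@leq_trans (4 ^ m.+1 * 4 ^ m)); last by rewrite -expnD leq_exp2l; lia.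
apply: leq_mul; first by apply: IHk; lia.
apply: leq_trans (bin_half_le m); apply: dvdn_leq; first by rewrite bin_gt0; lia.
apply: prod_primes_dvd; first exact: iota_uniq.
move=> p; rewrite mem_index_iota => /andP[le_mp lt_pm] p_prime.
rewrite p_prime /=.
have: p %| (m.*2.+1)`! by rewrite dvdn_fact //; lia.
rewrite -(@bin_fact m.*2.+1 m); last by lia.
have -> : m.*2.+1 - m = m.+1 by lia.
rewrite Euclid_dvdM // [p %| m`! * _]Euclid_dvdM //.
have ndvd j : j < p -> p %| j`! = false.
  elim: j => [|j IHj] lt_jp; first by rewrite fact0 dvdn1 gtn_eqF ?prime_gt1.
  by rewrite factS Euclid_dvdM // IHj ?orbF ?gtnNdvd //; lia.
by rewrite !ndvd ?orbF // ltnW.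
Qed.

(** * Valuations and multiples of d in classes mod 3 *)

Lemma logn_prodn (I : Type) (r : seq I) (P : pred I) (F : I -> nat) p :
  (forall i, P i -> 0 < F i) ->
  logn p (\prod_(i <- r | P i) F i) = \sum_(i <- r | P i) logn p (F i).
Proof.
move=> F_gt0; elim: r => [|i r IHr]; first by rewrite !big_nil logn1.
rewrite !big_cons; case: ifP => // Pi; rewrite lognM ?F_gt0 ?IHr //.
by rewrite prodn_cond_gt0.
Qed.

(** The terms with k >= m vanish because p^k > k. A bound [n] common to all factors of a product is
    what allows the sums to be exchanged in [logn_prod_range]. *)
Lemma logn_sum_dvd p m n : prime p -> 0 < m <= n ->
  logn p m = \sum_(1 <= k < n.+1) (p ^ k %| m).
Proof.
move=> p_prime /andP[m_gt0 le_mn]; rewrite logn_count_dvd //.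
rewrite [RHS](@big_cat_nat _ _ _ m) //=; last by lia.
rewrite [X in _ + X](_ : _ = 0) ?addn0 // big_nat big1 // => k /andP[le_mk _].
by rewrite gtnNdvd // (leq_ltn_trans le_mk) // ltn_expl ?prime_gt1.
Qed.

(** The multiple jd is congruent to a exactly when j = ac mod 3, since c is its own inverse mod
    3. *)
Lemma count_dvd_class n d a c : d %% 3 = c -> 0 < c -> 0 < a < 3 ->
  \sum_(1 <= m < n.+1 | m %% 3 == a) (d %| m) = (n %/ d + 3 - (a * c) %% 3) %/ 3.
Proof.
move=> dc c0 a0.
have d0 : 0 < d by lia.
elim: n => [|n IHn]; first by rewrite big_geq // div0n; nia.
rewrite big_mkcond big_nat_recr //= -big_mkcond IHn /= divnS //.
have [d_n|] := boolP (d %| n.+1); last by case: ifP => _; rewrite addn0.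
have [j def_n] := dvdnP d_n.
have def_j : n %/ d = j.-1 by move: (divnS n d0); rewrite d_n def_n mulnK //= => ->.
have j_gt0 : 0 < j by case: j def_n {def_j}.
have -> : n.+1 %% 3 = ((j %% 3) * c) %% 3 by rewrite def_n -modnMml -modnMmr dc.
rewrite def_j.
have: c = 1 \/ c = 2 by lia.
have: a = 1 \/ a = 2 by lia.
by case=> ->; case=> ->; case: eqP => /=; lia.
Qed.

Lemma count_dvd_coprime n d : ~~ (3 %| d) ->
  \sum_(1 <= m < n.+1 | ~~ (3 %| m)) (d %| m) = n %/ d - n %/ d %/ 3.
Proof.
move=> d3.
have d0 : 0 < d by lia.
elim: n => [|n IHn]; first by rewrite big_geq // div0n; nia.
rewrite big_mkcond big_nat_recr //= -big_mkcond IHn /= divnS //.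
have [d_n|] := boolP (d %| n.+1); last by case: ifP => _; rewrite addn0.
have [j def_n] := dvdnP d_n.
have def_j : n %/ d = j.-1 by move: (divnS n d0); rewrite d_n def_n mulnK //= => ->.
have j_gt0 : 0 < j by case: j def_n {def_j}.
rewrite def_j def_n Euclid_dvdM // (negPf d3) orbF.
by case: ifP => /=; lia.
Qed.

(** * Comparison of the products N and D *)

Lemma prod_class_recr a s : 0 < a < 3 ->
  \prod_(1 <= m < (6 * s.+1).+1 | m %% 3 == a) m =
  \prod_(1 <= m < (6 * s).+1 | m %% 3 == a) m * ((6 * s + a) * (6 * s + 3 + a)).
Proof.
move=> a3; rewrite big_mkcond [in RHS]big_mkcond.
have -> : 6 * s.+1 = (6 * s).+1.+1.+1.+1.+1.+1 by lia.
rewrite !(@big_nat_recr _ _ _ _.+1 1) //=.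
set P := \prod_(_ <= _ < _) _.
have E1 : ((6 * s).+1 %% 3 == a) = (a == 1) by lia.
have E2 : ((6 * s).+2 %% 3 == a) = (a == 2) by lia.
have E3 : ((6 * s).+3 %% 3 == a) = false by lia.
have E4 : ((6 * s).+4 %% 3 == a) = (a == 1) by lia.
have E5 : ((6 * s).+4.+1 %% 3 == a) = (a == 2) by lia.
have E6 : ((6 * s).+4.+2 %% 3 == a) = false by lia.
rewrite ?E1 ?E2 ?E3 ?E4 ?E5 ?E6.
have: a = 1 \/ a = 2 by lia.
by case=> -> /=; rewrite !muln1 -mulnA; congr (_ * (_ * _)); rewrite ?addnS ?addn0.
Qed.

Lemma prod_coprime_recr s :
  \prod_(1 <= m < (3 * s.+1).+1 | ~~ (3 %| m)) m =
  \prod_(1 <= m < (3 * s).+1 | ~~ (3 %| m)) m * ((3 * s + 1) * (3 * s + 2)).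
Proof.
rewrite big_mkcond [in RHS]big_mkcond.
have -> : 3 * s.+1 = (3 * s).+1.+1.+1 by lia.
rewrite !(@big_nat_recr _ _ _ _.+1 1) //=.
set P := \prod_(_ <= _ < _) _.
have -> : 3 %| (3 * s).+1 = false by lia.
have -> : 3 %| (3 * s).+2 = false by lia.
have -> : 3 %| (3 * s).+3 by lia.
by rewrite /= muln1 -mulnA !addnS !addn0.
Qed.

(** From s to s + 1 the ratio N / D grows by (6s + a)(6s + 3 + a) / ((3s + 1)(3s + 2)), smallest for
    a = 1. This is at least 4s / (s + 1), and these losses telescope into the factor 2s. *)
Lemma prod_class_ge a s : 0 < a < 3 -> 0 < s ->
  4 ^ s * \prod_(1 <= m < (3 * s).+1 | ~~ (3 %| m)) m
    <= 2 * s * \prod_(1 <= m < (6 * s).+1 | m %% 3 == a) m.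
Proof.
move=> a3; case: s => // s _; elim: s => [|s IHs].
  have [->|->] : a = 1 \/ a = 2 by lia.
    by rewrite unlock.
  by rewrite unlock.
rewrite prod_class_recr // prod_coprime_recr expnS.
set D := \prod_(_ <= _ < _ | _) _ in IHs *.
set N := \prod_(_ <= _ < _ | _) _ in IHs *.
have -> : 4 * 4 ^ s.+1 * (D * ((3 * s.+1 + 1) * (3 * s.+1 + 2)))
  = 4 ^ s.+1 * D * (4 * ((3 * s.+1 + 1) * (3 * s.+1 + 2))) by ring.
have -> : 2 * s.+2 * (N * ((6 * s.+1 + a) * (6 * s.+1 + 3 + a)))
  = N * 2 * (s.+2 * ((6 * s.+1 + a) * (6 * s.+1 + 3 + a))) by ring.
apply: leq_trans (leq_mul IHs (leqnn _)) _.
have -> : 2 * s.+1 * N * (4 * ((3 * s.+1 + 1) * (3 * s.+1 + 2)))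
  = N * 2 * (s.+1 * (4 * ((3 * s.+1 + 1) * (3 * s.+1 + 2)))) by ring.
apply: leq_mul => //; move: s.+1 (erefl s.+1) => t _.
apply: (@leq_trans (t.+1 * ((6 * t + 1) * (6 * t + 4)))); first by nia.
by rewrite leq_mul // leq_mul //; lia.
Qed.

Lemma logn_prod_range p (P : pred nat) n x : prime p -> n <= x ->
  logn p (\prod_(1 <= m < n.+1 | P m) m) =
  \sum_(1 <= k < x.+1) \sum_(1 <= m < n.+1 | P m) (p ^ k %| m).
Proof.
move=> p_prime le_nx; rewrite big_nat_cond logn_prodn; last by move=> m; lia.
rewrite exchange_big /= [RHS]big_nat_cond; apply: eq_bigr => m m_range.
by apply: logn_sum_dvd => //; lia.
Qed.

(* With y = 6s / d, the two sums count the j <= y with jd = a mod 3 and the    *)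
(* j <= y / 2 prime to 3; the bounds follow from y alone, y < 7 in the second. *)
Lemma count_class_le s a d : ~~ (3 %| d) -> 0 < a < 3 ->
  let N := \sum_(1 <= m < (6 * s).+1 | m %% 3 == a) (d %| m) in
  let D := \sum_(1 <= m < (3 * s).+1 | ~~ (3 %| m)) (d %| m) in
  [/\ N <= D + (d <= 6 * s)
    & 6 * s %/ 7 < d -> N <= D + [&& 3 * s < d, d <= 6 * s & d %% 3 == a]].
Proof.
move=> d3 a3 N D.
have d0 : 0 < d by lia.
have c12 : d %% 3 = 1 \/ d %% 3 = 2 by lia.
have a12 : a = 1 \/ a = 2 by lia.
rewrite /N /D (count_dvd_class (6 * s) (erefl (d %% 3))) //; last by lia.
rewrite count_dvd_coprime //.
have -> : 3 * s %/ d = 6 * s %/ d %/ 2.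
  by rewrite -divnMA [d * 2]mulnC divnMA; congr (_ %/ _); lia.
have le_d : (d <= 6 * s) = (0 < 6 * s %/ d) by rewrite divn_gt0.
have lt_d : (3 * s < d) = (6 * s %/ d < 2).
  by rewrite ltn_divLR //; lia.
have d7 : (6 * s %/ 7 < d) = (6 * s %/ d < 7).
  by rewrite !ltn_divLR // [d * 7]mulnC.
rewrite d7 lt_d le_d; move: (6 * s %/ d) => y.
move: (d %% 3) c12 => c c12.
by case: a12 c12 => ->; case=> ->; split; lia.
Qed.

Lemma prod_class_dvd a s t : 0 < a < 3 -> 6 * s < t.+1 ^ 2 ->
  \prod_(1 <= m < (6 * s).+1 | m %% 3 == a) m %|
  \prod_(1 <= m < (3 * s).+1 | ~~ (3 %| m)) m *
    (\prod_(1 <= p < t.+1 | prime p) p ^ trunc_log p (6 * s) *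
     \prod_(1 <= p < (6 * s %/ 7).+1 | prime p) p *
     \prod_((3 * s).+1 <= p < (6 * s).+1 | prime p && (p %% 3 == a)) p).
Proof.
move=> a3 lt_st.
set N := \prod_(_ <= _ < _ | _) _; set D := \prod_(_ <= _ < _ | ~~ _) _.
set B1 := \prod_(_ <= _ < _ | _) _; set B2 := \prod_(_ <= _ < _ | _) _.
set B3 := \prod_(_ <= _ < _ | _) _.
have N_gt0 : 0 < N by rewrite /N big_nat_cond prodn_cond_gt0 // => m; lia.
apply/dvdn_partP => // p; rewrite mem_primes => /and3P[p_prime _ p_N].
rewrite p_part.
have p_gt0 := prime_gt0 p_prime.
have p3 : ~~ (3 %| p).
  apply: contraL p_N => p3; rewrite Euclid_dvd_prod // big_has_cond.
  apply/hasPn => m _; apply/negP=> /andP[ma pm].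
  by have := dvdn_trans p3 pm; lia.
have pk3 k : ~~ (3 %| p ^ k) by rewrite Euclid_dvdX // negb_and p3.
pose n_ k := \sum_(1 <= m < (6 * s).+1 | m %% 3 == a) (p ^ k %| m).
pose d_ k := \sum_(1 <= m < (3 * s).+1 | ~~ (3 %| m)) (p ^ k %| m).
have logN : logn p N = \sum_(1 <= k < (6 * s).+1) n_ k.
  exact: logn_prod_range.
have logD : logn p D = \sum_(1 <= k < (6 * s).+1) d_ k.
  by apply: logn_prod_range => //; lia.
(* By Legendre's formula it suffices to bound the excess [e] of the valuation of N over that of D,
   prime by prime: p <= t is absorbed by B1, t < p <= 6s/7 by B2, and larger p by B3. *)
have [e leNe dvd_e] : exists2 e, logn p N <= logn p D + e & p ^ e %| B1 * B2 * B3.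
  have [le_pt|lt_tp] := leqP p t.
    exists (trunc_log p (6 * s)); last first.
      rewrite !dvdn_mulr // /B1 (big_rem p) /=; last by rewrite mem_index_iota; lia.
      by rewrite p_prime dvdn_mulr.
    apply: (@leq_trans (\sum_(1 <= k < (6 * s).+1)
        (d_ k + (k <= trunc_log p (6 * s))))).
      rewrite logN; apply: leq_sum => k _.
      have [le1 _] := count_class_le s (pk3 k) a3; apply: leq_trans le1 _.
      rewrite leq_add2l; case: (leqP (p ^ k) (6 * s)) => //= le_pk.
      by rewrite trunc_log_max // prime_gt1.
    rewrite big_split /= -logD leq_add2l.
    have sumE L n : \sum_(1 <= k < n.+1) (k <= L) = minn n L.
      elim: n => [|n IHn]; first by rewrite big_geq ?min0n.
      by rewrite big_nat_recr //= IHn; case: leqP; lia.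
    by rewrite sumE geq_minr.
  (* Beyond the square root of 6s only k = 1 contributes, so the excess is at most 1. *)
  have big_pk k : 1 < k -> 6 * s < p ^ k.
    move=> k_gt1; apply: leq_trans lt_st _.
    apply: (@leq_trans (p ^ 2)); first by rewrite leq_exp2r.
    by rewrite leq_pexp2l.
  have [s0|s_gt0] := posnP s.
    exists 0; last by rewrite dvd1n.
    by rewrite /N s0 big_geq ?logn1.
  have log1 (P : pred nat) n : n <= 6 * s -> 
      \sum_(1 <= k < (6 * s).+1) \sum_(1 <= m < n.+1 | P m) (p ^ k %| m) =
      \sum_(1 <= m < n.+1 | P m) (p %| m).
    move=> le_n; rewrite big_ltn ?ltnS ?muln_gt0 //.
    rewrite [X in _ + X](_ : _ = 0) ?addn0 //.
    rewrite big_nat big1 // => k /andP[k_gt1 _].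
    rewrite big_nat_cond big1 // => m m_range.
    by rewrite gtnNdvd //; [|have := big_pk k k_gt1]; lia.
  have [] := count_class_le s p3 a3; rewrite -!(log1 _ _) //; last by lia.
  rewrite -logN -logD => le1 le2.
  have [le_p7|lt_7p] := leqP p (6 * s %/ 7).
    exists (p <= 6 * s) => //.
    rewrite -mulnA mulnCA dvdn_mulr // /B2 (big_rem p) /=.
      by rewrite p_prime dvdn_mulr //; case: (_ <= _); rewrite ?dvd1n.
    by rewrite mem_index_iota; lia.
  exists [&& 3 * s < p, p <= 6 * s & p %% 3 == a]; first exact: le2.
  case: (boolP [&& _, _ & _]) => [/and3P[lt_sp le_ps p_a]|_]; last by rewrite dvd1n.
  rewrite dvdn_mull // /B3 (big_rem p) /=; last by rewrite mem_index_iota; lia.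
  by rewrite p_prime p_a dvdn_mulr.
rewrite (dvdn_trans (dvdn_exp2l p leNe)) // expnD dvdn_mul //.
exact: pfactor_dvdnn.
Qed.

(** * A Bertrand postulate in the classes mod 3 *)

Lemma exp_quadratic_gt t : 381 <= t -> t.+1 ^ (42 * (t + 2)) < 2 ^ (t ^ 2).
Proof.
move=> le_t; set k := trunc_log 2 t.+1.
have lt_tk : t.+1 < 2 ^ k.+1 by apply: trunc_log_ltn.
have le_kt : 2 ^ k <= t.+1 by apply: trunc_logP.
apply: (@leq_trans ((2 ^ k.+1) ^ (42 * (t + 2)))).
  by rewrite ltn_exp2r //; lia.
rewrite -expnM leq_exp2l // expnS expn1.
(* The claim is now 42(k + 1)(t + 2) <= t^2. For k <= 8 the left side is at most 378(t + 2), whence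
   the threshold 381; for k >= 9, t + 1 >= 2^k is large enough. *)
have [le_k8|lt_8k] := leqP k 8; first by nia.
have le_k : 42 * k.+1 + 44 <= 2 ^ k.
  rewrite -(subnK lt_8k); elim: (k - 9) => // i IHi.
  by rewrite addSn expnS; lia.
by nia.
Qed.

(* 6 * 242 * 100 >= 381^2, as exp_quadratic_gt requires.                       *)
Lemma prime_class_other s a q :
  242 * 100 <= s -> 0 < a < 3 -> prime q -> q <= 6 * s ->
  exists r, [/\ prime r, r %% 3 = a, r != q & 3 * s < r <= 6 * s].
Proof.
move=> le_s a3 q_prime le_qs.
have [|no_r] := boolP (has (fun r => [&& prime r, r %% 3 == a & r != q])
    (index_iota (3 * s).+1 (6 * s).+1)).
  case/hasP=> r; rewrite mem_index_iota => r_range /and3P[r_prime /eqP r_a r_q].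
  by exists r; split=> //; lia.
have [t /andP[le_ts lt_st]] : exists t, t ^ 2 <= 6 * s < t.+1 ^ 2.
  elim: (6 * s) => [|n [t IHt]]; first by exists 0.
  have [lt_nt|le_tn] := ltnP n.+1 (t.+1 ^ 2); first by exists t; lia.
  by exists t.+1; move: IHt le_tn; rewrite !expnS !expn0; lia.
have le_t : 381 <= t.
  rewrite leqNgt; apply/negP=> lt_t; have := leq_mul lt_t lt_t.
  by move: lt_st; rewrite -mulnn; lia.
have := prod_class_dvd a3 lt_st; have := @prod_class_ge a s a3.
set D := \prod_(_ <= _ < _ | ~~ _) _; set N := \prod_(_ <= _ < _ | _) _.
set B1 := \prod_(_ <= _ < _ | _) _; set B2 := \prod_(_ <= _ < _ | _) _.
set B3 := \prod_(_ <= _ < _ | _) _.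
have D_gt0 : 0 < D by rewrite /D big_nat_cond prodn_cond_gt0 // => m; lia.
have leB1 : B1 <= (6 * s) ^ t.
  have -> : (6 * s) ^ t = \prod_(1 <= p < t.+1) (6 * s).
    by rewrite prod_nat_const_nat subn1.
  rewrite /B1 big_mkcond; apply: leq_prod => p _.
  by case: ifP => [/prime_gt1 p_gt1|_]; [apply: trunc_logP | ]; lia.
have leB2 : B2 <= 4 ^ (6 * s %/ 7) by apply: primorial_le.
(* By [no_r], [q] is the only prime that can occur in B3, so B3 divides [q]. *)
have leB3 : B3 <= 6 * s.
  apply: leq_trans le_qs; apply: dvdn_leq; first exact: prime_gt0.
  apply: prod_primes_dvd; first exact: iota_uniq.
  move=> p p_range /andP[p_prime p_a]; rewrite p_prime /=.
  by move/hasPn: no_r => /(_ _ p_range); rewrite p_prime p_a /= negbK => /eqP->.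
have B_gt0 : 0 < B1 * B2 * B3.
  rewrite /B1 /B2 /B3 !muln_gt0 !prodn_cond_gt0 // => p.
  - by case/andP => /prime_gt0.
  - exact: prime_gt0.
  by move=> /prime_gt0 p_gt0; rewrite expn_gt0 p_gt0.
move=> /(_ ltac:(lia)) leDN N_dvd.
have {N_dvd} leN : N <= D * (B1 * B2 * B3).
  by apply: dvdn_leq N_dvd; rewrite muln_gt0 D_gt0.
(* The exponent t + 2 counts t for B1, one for B3 and one for the factor 2s. *)
have le4 : 4 ^ s <= (6 * s) ^ (t + 2) * 4 ^ (6 * s %/ 7).
  rewrite -(leq_pmul2r D_gt0); apply: leq_trans leDN _.
  apply: leq_trans (leq_mul (leqnn _) leN) _.
  rewrite mulnCA mulnC leq_pmul2r //.
  apply: (@leq_trans (6 * s * ((6 * s) ^ t * 4 ^ (6 * s %/ 7) * (6 * s)))).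
    by rewrite !leq_mul //; lia.
  by rewrite addn2 !expnS; apply: eq_leq; ring.
(* The seventh power clears the floor of 6s/7. *)
have {}le4 : 4 ^ s <= (6 * s) ^ (7 * (t + 2)).
  have: 4 ^ (7 * s) <= (6 * s) ^ (7 * (t + 2)) * 4 ^ (6 * s).
    apply: (@leq_trans (((6 * s) ^ (t + 2) * 4 ^ (6 * s %/ 7)) ^ 7)).
      by rewrite mulnC expnM leq_exp2r.
    rewrite expnMn -!expnM mulnC [in X in _ <= X]mulnC [7 * _]mulnC.
    by rewrite leq_pmul2r ?leq_exp2l ?expn_gt0 //; lia.
  have -> : 7 * s = s + 6 * s by lia.
  by rewrite expnD leq_pmul2r ?expn_gt0.
have le2 : 2 ^ s <= t.+1 ^ (7 * (t + 2)).
  rewrite -(@leq_exp2r _ _ 2) // -expnM mulnC expnM; apply: leq_trans le4 _.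
  by rewrite expnAC leq_exp2r ?(ltnW lt_st) //; lia.
(* Sixth power, with t^2 <= 6s; this yields the exponent 42. *)
have: 2 ^ (t ^ 2) <= t.+1 ^ (42 * (t + 2)).
  apply: (@leq_trans ((2 ^ s) ^ 6)); first by rewrite -expnM leq_exp2l // mulnC.
  have -> : 42 * (t + 2) = 7 * (t + 2) * 6 by lia.
  by rewrite expnM leq_exp2r.
by rewrite leqNgt exp_quadratic_gt.
Qed.

(** The first entry exceeding q has a predecessor that is at most q. *)
Lemma chain_next (R : seq nat) x q : path (fun y z => z <= 2 * y - 3) x R ->
  x <= q < last x R -> exists2 r, r \in R & q < r <= 2 * q - 3.
Proof.
elim: R x => [|y R IHR] x /=; first by lia.
case/andP=> le_yx yR /andP[le_xq lt_q].
have [lt_qy|le_yq] := ltnP q y.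
  by exists y; rewrite ?mem_head //; lia.
have [|r r_R r_q] := IHR y yR; first by rewrite le_yq.
by exists r => //; rewrite inE r_R orbT.
Qed.

Lemma prime_class_next q : prime q -> 11 <= q ->
  exists r, [/\ prime r, r %% 3 = q %% 3, q < r & r <= 2 * q - 3].
Proof.
move=> q_prime q_ge.
have q3 : q %% 3 = 1 \/ q %% 3 = 2.
  have: ~~ (3 %| q) by rewrite dvdn_prime2 //; lia.
  lia.
have q_odd : q %% 2 = 1 by case: (even_prime q_prime); lia.
(* For s = floor(q/3), a prime r != q with r > 3s and r = q mod 3 exceeds q; being prime to 3, it
   satisfies r < 6s <= 2q - 2. *)
have [le_q|lt_q] := leqP (726 * 100) q.
  have [| | |r [r_prime r3 r_q r_range]] :=
    @prime_class_other (q %/ 3) (q %% 3) q _ _ q_prime; try lia.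
  have r_odd : r %% 2 = 1 by case: (even_prime r_prime); lia.
  by exists r; split=> //; move/eqP: r_q; lia.
(* Primes congruent to 1, resp. 2, mod 3, continuing 13, resp. 11; each is at most twice its
   predecessor minus 3, and the last exceeds 72600. *)
pose R1 := [:: 19; 31; 43; 79; 151; 283; 547; 1087; 2161; 4297; 8581; 17137;
  34267; 68521; 137029].
pose R2 := [:: 17; 29; 53; 101; 197; 389; 773; 1523; 3041; 6053; 12101; 24197;
  48383; 96749].
have chain a x R : all (fun r => prime r && (r %% 3 == a)) R ->
    path (fun y z => z <= 2 * y - 3) x R -> q %% 3 = a -> x <= q < last x R ->
    exists r, [/\ prime r, r %% 3 = q %% 3, q < r & r <= 2 * q - 3].
  move=> /allP R_a R_path -> /(chain_next R_path)[r /R_a/andP[r_prime /eqP r_a]].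
  move=> /andP[lt_qr le_r].
  by exists r.
case: q3 => q3.
  apply: (chain 1 13 R1 _ _ q3); [by vm_compute | by vm_compute |].
  apply/andP; split; first by lia.
  by apply: (leq_trans lt_q); vm_compute.
apply: (chain 2 11 R2 _ _ q3); [by vm_compute | by vm_compute |].
apply/andP; split; first by lia.
by apply: (leq_trans lt_q); vm_compute.
Qed.

(** * Coefficients of 'Psi_3qr *)

Import Order.TTheory GRing.Theory Num.Theory.
Local Open Scope ring_scope.

Lemma flat_coef (p : {poly int}) :
  (forall k, `|p`_k| <= 1) -> p`_0 != 0 -> flat p.
Proof.
move=> p_le1 p0; rewrite /flat /height; apply/eqP.
rewrite eqn_leq; apply/andP; split.
  by apply/bigmax_leqP => i _; have := p_le1 i; lia.
have size_gt0 : (0 < size p)%N.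
  by rewrite size_poly_gt0; apply: contraNneq p0 => ->; rewrite coef0.
apply: leq_trans
  (@leq_bigmax _ (fun i : 'I_(size p) => absz p`_i) (Ordinal size_gt0)).
by rewrite absz_gt0.
Qed.

Lemma not_flat_coef (p : {poly int}) k : 1 < `|p`_k| -> ~ flat p.
Proof.
move=> pk; rewrite /flat /height => max1.
have [le_pk|lt_kp] := leqP (size p) k.
  by move: pk; rewrite nth_default // normr0.
have := @leq_bigmax _ (fun i : 'I_(size p) => absz p`_i) (Ordinal lt_kp).
by rewrite max1 /= leqNgt -ltz_nat abszE pk.
Qed.

(** * Cyclotomic polynomials under x -> x^p *)

(** Over the divisors of n, both sides have product x^(np) - 1: the divisors of np are the dp with d
    | n and the divisors of n prime to p. Strong induction cancels the factors with d < n. *)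
Lemma Cyclotomic_comp_Xn n p : prime p -> (0 < n)%N ->
  'Phi_n \Po 'X^p = 'Phi_(n * p) * (if (p %| n)%N then 1 else 'Phi_n).
Proof.
move=> p_prime; have p_gt0 := prime_gt0 p_prime.
pose g n : {poly int} := 'Phi_(n * p) * (if (p %| n)%N then 1 else 'Phi_n).
have prod_g m : (0 < m)%N -> \prod_(d <- divisors m) g d = 'X^(m * p) - 1.
  move=> m_gt0; have mp_gt0 : (0 < m * p)%N by rewrite muln_gt0 m_gt0.
  rewrite big_split /= -prod_Cyclotomic // [RHS](bigID (dvdn p)) /=.
  congr (_ * _); last first.
    rewrite (eq_bigr (fun d => if ~~ (p %| d)%N then 'Phi_d else 1)); last first.
      by move=> d _; case: ifP.
    rewrite -big_mkcond -[LHS]big_filter -[RHS]big_filter; apply: perm_big.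
    apply: uniq_perm; rewrite ?filter_uniq ?divisors_uniq // => d.
    rewrite !mem_filter -!dvdn_divisors //; case: (boolP (p %| d)%N) => //= pd.
    by rewrite Gauss_dvdl // coprime_sym prime_coprime.
  rewrite -[RHS]big_filter -(big_map (muln^~ p) predT (fun e => 'Phi_e)).
  apply: perm_big; apply: uniq_perm.
  - rewrite map_inj_uniq ?divisors_uniq // => d e /eqP.
    by rewrite eqn_pmul2r // => /eqP.
  - by rewrite filter_uniq ?divisors_uniq.
  move=> e; rewrite mem_filter -dvdn_divisors //; apply/mapP/andP.
    case=> d; rewrite -dvdn_divisors // => d_m ->.
    by rewrite dvdn_mull // dvdn_pmul2r.
  case=> /dvdnP[d ->]; rewrite dvdn_pmul2r // => d_m.
  by exists d => //; rewrite -dvdn_divisors.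
have [k] := ubnP n; elim: k n => // k IHk n lt_nk n_gt0.
have := prod_g n n_gt0.
have -> : 'X^(n * p) - 1 = ('X^n - 1) \Po 'X^p :> {poly int}.
  by rewrite comp_polyB comp_Xn_poly comp_polyC -exprM mulnC.
rewrite -prod_Cyclotomic // rmorph_prod /=.
have n_n : n \in divisors n by rewrite -dvdn_divisors.
rewrite !(big_rem n n_n) /=.
have -> : \prod_(d <- rem n (divisors n)) g d =
    \prod_(d <- rem n (divisors n)) ('Phi_d \Po 'X^p).
  apply: eq_big_seq => d; rewrite mem_rem_uniq ?divisors_uniq // !inE.
  rewrite -dvdn_divisors // => /andP[neq_dn d_n].
  have d_gt0 := dvdn_gt0 n_gt0 d_n.
  by rewrite IHk //; have := dvdn_leq n_gt0 d_n; move/eqP: neq_dn; lia.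
move/mulIf => <- //.
rewrite prodf_seq_neq0; apply/allP=> d /mem_rem; rewrite -dvdn_divisors // => d_n.
rewrite comp_poly_eq0 ?size_polyXn ?ltnS //.
exact: monic_neq0 (Cyclotomic_monic d).
Qed.

Lemma invCyclotomic_mul_prime n p : prime p -> (0 < n)%N ->
  'Psi_(n * p) = ('Psi_n \Po 'X^p) * (if (p %| n)%N then 1 else 'Phi_n).
Proof.
move=> p_prime n_gt0; have p_gt0 := prime_gt0 p_prime.
apply: (mulIf (monic_neq0 (Cyclotomic_monic (n * p)))).
rewrite invCyclotomicK ?muln_gt0 ?n_gt0 //.
rewrite -mulrA [_ * 'Phi_(n * p)]mulrC -Cyclotomic_comp_Xn // -comp_polyM.
rewrite invCyclotomicK //.
by rewrite comp_polyB comp_Xn_poly comp_polyC -exprM mulnC.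
Qed.

Lemma Cyclotomic1 : 'Phi_1 = 'X - 1.
Proof.
by have := prod_Cyclotomic (isT : (0 < 1)%N); rewrite big_cons big_nil mulr1.
Qed.

Lemma Cyclotomic3 : 'Phi_3 = 1 + 'X + 'X^2.
Proof.
have := @Cyclotomic_comp_Xn 1 3 isT isT; rewrite /= Cyclotomic1 => E.
apply: (@mulIf _ ('X - 1)); first by rewrite -polyC1 polyXsubC_eq0.
by rewrite -[3%N]/(1 * 3)%N -E comp_polyB comp_polyX comp_polyC polyC1; ring.
Qed.

Lemma invCyclotomic3 : 'Psi_3 = 'X - 1.
Proof.
have Psi1 : 'Psi_1 = 1.
  apply: (mulIf (monic_neq0 (Cyclotomic_monic 1))).
  by rewrite invCyclotomicK // Cyclotomic1 expr1 mul1r.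
rewrite -[3%N]/(1 * 3)%N invCyclotomic_mul_prime // Psi1 Cyclotomic1.
by rewrite comp_polyC mul1r.
Qed.

Lemma prime_mod3 q : prime q -> q != 3 -> (q %% 3 != 0)%N.
Proof.
by move=> q_prime q_neq3; rewrite -[_ == _]/(3 %| q)%N dvdn_prime2 // eq_sym.
Qed.

Lemma invCyclotomic3q q : prime q -> q != 3 ->
  'Psi_(3 * q) = ('X^q - 1) * (1 + 'X + 'X^2).
Proof.
move=> q_prime q_neq3; rewrite invCyclotomic_mul_prime // invCyclotomic3.
rewrite dvdn_prime2 // (negPf q_neq3) Cyclotomic3.
by rewrite comp_polyB comp_polyX comp_polyC.
Qed.

Lemma Cyclotomic3q_mul q : prime q -> q != 3 ->
  'Phi_(3 * q) * (1 + 'X + 'X^2) = 1 + 'X^q + 'X^(2 * q).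
Proof.
move=> q_prime q_neq3; have := @Cyclotomic_comp_Xn 3 q q_prime isT.
rewrite dvdn_prime2 // (negPf q_neq3) Cyclotomic3 => <-.
by rewrite !comp_polyD comp_polyC comp_polyX comp_Xn_poly -exprM mulnC.
Qed.

(* Coefficients of the power series (1 - x) / (1 - x^3) = 1 / 'Phi_3.          *)
Definition invPhi3_coef (k : nat) : int := (k %% 3 == 0)%N%:Z - (k %% 3 == 1)%N%:Z.

Definition shift_coef (c : nat -> int) (n k : nat) : int :=
  if (k < n)%N then 0 else c (k - n)%N.

(** The series (1 + x^q + x^2q) / 'Phi_3 cut after degree 2q - 2, where its third summand has not
    begun. *)
Definition Phi3q_coef (q k : nat) : int :=
  if (k < 2 * q - 1)%N then invPhi3_coef k + shift_coef invPhi3_coef q k else 0.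

(** * Explicit coefficients of 'Phi_3q *)

Lemma invPhi3_coef_sum3 k :
  invPhi3_coef k.+2 + invPhi3_coef k.+1 + invPhi3_coef k = 0.
Proof. by rewrite /invPhi3_coef; lia. Qed.

Lemma invPhi3_coef_mod a b : (a %% 3 = b %% 3)%N -> invPhi3_coef a = invPhi3_coef b.
Proof. by rewrite /invPhi3_coef => ->. Qed.

Lemma shift_invPhi3_sum3 n k : shift_coef invPhi3_coef n k.+2 +
  shift_coef invPhi3_coef n k.+1 + shift_coef invPhi3_coef n k = (k.+2 == n)%N%:Z.
Proof.
rewrite /shift_coef; have [lt_k2n|] := ltnP k.+2 n.
  by rewrite !ifT ?ltn_eqF //; lia.
rewrite leq_eqVlt => /orP[/eqP->|].
  by rewrite subnn eqxx /= !ifT ?addr0 //; lia.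
rewrite ltnS leq_eqVlt => /orP[/eqP->|].
  by rewrite subSnn subnn ltnn /= ifT ?gtn_eqF //; lia.
rewrite ltnS => le_nk; rewrite /= !ifF ?gtn_eqF //; try lia.
by rewrite !subSn ?invPhi3_coef_sum3 //; lia.
Qed.

(** The cut loses nothing: 0, q and 2q represent all classes mod 3, so the three shifts cancel from
    degree 2q on, and the first two already cancel at 2q - 1. *)
Lemma Phi3q_coefE q k : (1 < q)%N -> (q %% 3 != 0)%N ->
  Phi3q_coef q k = invPhi3_coef k + shift_coef invPhi3_coef q k
                   + shift_coef invPhi3_coef (2 * q) k.
Proof.
move=> q1 q3; rewrite /Phi3q_coef.
have [lt_k|le_k] := ltnP k (2 * q - 1).
  by rewrite {3}/shift_coef ifT ?addr0 //; lia.
rewrite /shift_coef (ltnNge k q) (_ : q <= k)%N /=; last by lia.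
have [lt_k|{}le_k] := ltnP k (2 * q).
  have -> : k = (q + q.-1)%N by lia.
  rewrite addKn addr0 /invPhi3_coef; lia.
have -> : k = (k - 2 * q + 2 * q)%N by lia.
move: (k - 2 * q)%N => j; rewrite addnK (_ : j + 2 * q - q = j + q)%N; last by lia.
have [q1'|q2'] : (q %% 3 = 1)%N \/ (q %% 3 = 2)%N by lia.
  rewrite -(invPhi3_coef_sum3 j).
  rewrite (@invPhi3_coef_mod (j + q) j.+1); last by lia.
  by rewrite (@invPhi3_coef_mod (j + 2 * q) j.+2) //; lia.
rewrite -(invPhi3_coef_sum3 j) [_ j.+2 + _]addrC.
rewrite (@invPhi3_coef_mod (j + q) j.+2); last by lia.
by rewrite (@invPhi3_coef_mod (j + 2 * q) j.+1) //; lia.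
Qed.

(** Both sides obey the recurrence expressing that the product with 'Phi_3 is 1 + x^q + x^2q. *)
Lemma coef_Cyclotomic3q q k : prime q -> q != 3 ->
  ('Phi_(3 * q))`_k = Phi3q_coef q k.
Proof.
move=> q_prime q_neq3.
have q3 := prime_mod3 q_prime q_neq3.
have q_gt1 := prime_gt1 q_prime.
have rec i : ('Phi_(3 * q))`_i + (if i is j.+1 then ('Phi_(3 * q))`_j else 0) +
   (if i is j.+2 then ('Phi_(3 * q))`_j else 0) =
   (i == 0)%N%:Z + (i == q)%N%:Z + (i == 2 * q)%N%:Z.
  have /(congr1 (fun p : {poly int} => p`_i)) := Cyclotomic3q_mul q_prime q_neq3.
  rewrite !mulrDr mulr1 !coefD coefMX coefMXn !coefXn coef1.
  by case: i => [|[|i]] //=; rewrite ?subn2 !natz.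
have [n] := ubnP k; elim: n k => // n IHn k lt_kn.
have q_lt2 : (1 < 2 * q - 1)%N by lia.
have := rec k; case: k lt_kn => [|[|k]] lt_kn.
- rewrite !addr0 /Phi3q_coef /shift_coef /= (ltnW q_lt2) (ltnW q_gt1) => ->.
  by rewrite ltn_eqF ?ltn_eqF //; lia.
- rewrite (IHn 0%N) // /Phi3q_coef /shift_coef.
  rewrite q_lt2 (ltnW q_lt2) q_gt1 (ltnW q_gt1) !addr0.
  rewrite (ltn_eqF q_gt1) (_ : (1 == 2 * q)%N = false); last by lia.
  by rewrite /invPhi3_coef /=; lia.
rewrite (IHn k.+1) // (IHn k); last by lia.
rewrite !Phi3q_coefE //.
move: (invPhi3_coef_sum3 k) (shift_invPhi3_sum3 q k) (shift_invPhi3_sum3 (2 * q) k).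
do 6!move: (shift_coef _ _ _).
by move=> x1 x2 x3 x4 x5 x6 e1 <- <- /=; lia.
Qed.

(** * Coefficients of 'Psi_3qr and flatness *)

(** A plain function on naturals, so that finite ranges can be settled by [vm_compute]. *)
Definition Psi3qr_coef (q r k : nat) : int :=
  shift_coef (Phi3q_coef q) (q * r) k + shift_coef (Phi3q_coef q) (q * r + r) k
  + shift_coef (Phi3q_coef q) (q * r + 2 * r) k
  - (shift_coef (Phi3q_coef q) 0 k + shift_coef (Phi3q_coef q) r k
     + shift_coef (Phi3q_coef q) (2 * r) k).

(** Used with [p] = 'Phi_3q when r does not divide 3q, and with [p] = 1 when it does. *)
Lemma coef_mul_invCyclotomic3q_comp (p : {poly int}) q r k : prime q -> q != 3 ->
  (p * ('Psi_(3 * q) \Po 'X^r))`_k =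
   shift_coef (fun i => p`_i) (q * r) k + shift_coef (fun i => p`_i) (q * r + r) k
   + shift_coef (fun i => p`_i) (q * r + 2 * r) k
   - (p`_k + shift_coef (fun i => p`_i) r k + shift_coef (fun i => p`_i) (2 * r) k).
Proof.
move=> q_prime q3; rewrite invCyclotomic3q // comp_polyM comp_polyB !comp_polyD.
rewrite !comp_polyC !comp_polyX !comp_Xn_poly -!exprM polyC1.
have -> : p * (('X^(r * q) - 1) * (1 + 'X^r + 'X^(r * 2))) =
  p * 'X^(q * r) + p * 'X^(q * r + r) + p * 'X^(q * r + 2 * r)
    - (p + p * 'X^r + p * 'X^(2 * r)).
  rewrite !(exprD 'X (q * r)) [(r * q)%N]mulnC [(r * 2)%N]mulnC.
  by move: ('X^(q * r)) ('X^r) ('X^(2 * r)) => u v w; ring.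
by rewrite coefB !coefD !coefMXn.
Qed.

Lemma coef_invCyclotomic3qr q r k :
  prime q -> q != 3 -> prime r -> r != 3 -> r != q ->
  ('Psi_(3 * q * r))`_k = Psi3qr_coef q r k.
Proof.
move=> q_prime q3 r_prime r3 rq.
have r_ndvd : (r %| 3 * q)%N = false.
  by rewrite Euclid_dvdM // !dvdn_prime2 // (negPf r3) (negPf rq).
rewrite invCyclotomic_mul_prime // ?muln_gt0 ?prime_gt0 // r_ndvd mulrC.
rewrite coef_mul_invCyclotomic3q_comp // /Psi3qr_coef /shift_coef ltn0 subn0.
by rewrite !coef_Cyclotomic3q.
Qed.

(** For k >= q the two summands sit at different residues mod 3, hence are never both 1 or both
    -1. *)
Lemma Phi3q_coef_bound q k : (q %% 3 != 0)%N -> `|Phi3q_coef q k| <= 1.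
Proof.
rewrite /Phi3q_coef /shift_coef /invPhi3_coef => q3.
by case: ltnP => _ //; case: ltnP => le_k; lia.
Qed.

Lemma Phi3q_coef0 q : (1 < q)%N -> Phi3q_coef q 0 = 1.
Proof. by move=> q1; rewrite /Phi3q_coef /shift_coef !ifT //; lia. Qed.

Lemma Phi3q_coef_eq0 q k : (2 * q - 1 <= k)%N -> Phi3q_coef q k = 0.
Proof. by rewrite /Phi3q_coef ltnNge => ->. Qed.

Lemma shift_Phi3q_bound q n k (u := shift_coef (Phi3q_coef q) n k) :
  (q %% 3 != 0)%N ->
  `|u| <= 1 /\ (u = 0 \/ n <= k < n + (2 * q - 1))%N.
Proof.
move=> q3; rewrite /u /shift_coef; case: ltnP => lt_kn; first by split; [|left].
split; first exact: Phi3q_coef_bound.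
have [le_k|lt_k] := leqP (2 * q - 1) (k - n).
  by left; rewrite Phi3q_coef_eq0 //; lia.
by right; lia.
Qed.

Lemma Psi3qr_coef0 q r : (1 < q)%N -> (0 < r)%N -> Psi3qr_coef q r 0 = -1.
Proof.
move=> q1 r0; rewrite /Psi3qr_coef /shift_coef !addn_gt0 !muln_gt0 r0 (ltnW q1) /=.
by rewrite Phi3q_coef0.
Qed.

Lemma shift_Phi3q_sum3 q r n k
    (u := shift_coef (Phi3q_coef q) n k + shift_coef (Phi3q_coef q) (n + r) k
          + shift_coef (Phi3q_coef q) (n + 2 * r) k) :
  (q %% 3 != 0)%N -> (2 * q - 1 <= r)%N ->
  `|u| <= 1 /\ (u = 0 \/ n <= k < n + 2 * r + (2 * q - 1))%N.
Proof.
move=> q3 le_r; rewrite /u.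
have [] := shift_Phi3q_bound n k q3; have [] := shift_Phi3q_bound (n + r) k q3.
have [] := shift_Phi3q_bound (n + 2 * r) k q3.
do 3!move: (shift_coef _ _ _).
move=> x1 x2 x3 x1_le [-> | k1] x2_le [-> | k2] x3_le [-> | k3]; lia.
Qed.

Lemma Psi3qr_coef_le q r k :
  (q %% 3 != 0)%N -> (5 <= q)%N -> (2 * q - 1 <= r)%N ->
  `|Psi3qr_coef q r k| <= 1.
Proof.
move=> q3 q5 le_r; rewrite /Psi3qr_coef.
(* Separates the three negative copies from the three positive ones; 3r <= qr suffices. *)
have: (2 * r + (2 * q - 1) <= q * r)%N by nia.
have := shift_Phi3q_sum3 (q * r) k q3 le_r; have := shift_Phi3q_sum3 0 k q3 le_r.
rewrite !add0n; move: (q * r)%N => u.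
do 2!move: (_ + _ + shift_coef _ _ _).
move=> x y [x_le [-> | kx]] [y_le [-> | ky]] le_u; lia.
Qed.

Lemma Psi3qr_coef_large q r k :
  (q %% 3 != 0)%N -> (q * r + 2 * r + 2 * q <= k)%N -> Psi3qr_coef q r k = 0.
Proof.
move=> q3; rewrite /Psi3qr_coef; have: (r <= q * r)%N by rewrite leq_pmull //; lia.
move: (q * r)%N => u le_r le_k.
have sh0 n : (n <= u + 2 * r)%N -> shift_coef (Phi3q_coef q) n k = 0.
  by move=> le_n; have [_ []] := shift_Phi3q_bound n k q3 => //; lia.
by rewrite !sh0 //; lia.
Qed.

Lemma Psi3qr_coef_le_check q r : (q %% 3 != 0)%N ->
  all (fun k => `|Psi3qr_coef q r k| <= 1) (iota 0 (q * r + 2 * r + 2 * q)) ->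
  forall k, `|Psi3qr_coef q r k| <= 1.
Proof.
move=> q3 /allP check k; have [le_k|lt_k] := leqP (q * r + 2 * r + 2 * q) k.
  by rewrite Psi3qr_coef_large.
by apply: check; rewrite mem_iota.
Qed.

Lemma flat_invCyclotomic3qr q r :
  prime q -> q != 3 -> prime r -> r != 3 -> r != q ->
  (forall k, `|Psi3qr_coef q r k| <= 1) -> flat 'Psi_(3 * q * r).
Proof.
move=> q_prime q3 r_prime r3 rq coef_le; apply: flat_coef => [k|].
  by rewrite coef_invCyclotomic3qr.
by rewrite coef_invCyclotomic3qr // Psi3qr_coef0 ?prime_gt0 ?prime_gt1.
Qed.

Lemma flat_invCyclotomic3qr_dvd q r :
  prime q -> (3 < q)%N -> prime r -> (r %| 3 * q)%N ->
  flat 'Psi_(3 * q * r).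
Proof.
move=> q_prime q_gt3 r_prime r_dvd.
have q3 : q != 3 by rewrite gtn_eqF.
have r_gt0 := prime_gt0 r_prime.
rewrite invCyclotomic_mul_prime ?muln_gt0 ?prime_gt0 // r_dvd mulrC.
have gt_qr : (2 * r < q * r)%N by rewrite ltn_pmul2r //; lia.
have shift1 n k : shift_coef (fun i => (1 : {poly int})`_i) n k = (k == n)%N%:Z.
  rewrite /shift_coef coef1 natz.
  case: ltnP => [lt_kn|le_nk]; first by rewrite ltn_eqF.
  by rewrite subn_eq0 eqn_leq le_nk andbT.
apply: flat_coef => [k|];
  rewrite coef_mul_invCyclotomic3q_comp // !shift1 coef1 natz.
  by move: (q * r)%N gt_qr => u gt_qr; lia.
by move: (q * r)%N gt_qr => u gt_qr; lia.
Qed.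

Lemma flat_invCyclotomic3q_5_7 (q r : nat) :
  q \in [:: 5; 7]%N -> prime r -> flat 'Psi_(3 * q * r).
Proof.
move=> q57 r_prime.
have [q_prime q_ge q_le] : [/\ prime q, (5 <= q)%N & (q <= 7)%N].
  by move: q57; rewrite !inE => /orP[] /eqP->.
have [r_dvd|r_ndvd] := boolP (r %| 3 * q)%N.
  by apply: flat_invCyclotomic3qr_dvd => //; exact: ltnW.
move: r_ndvd; rewrite Euclid_dvdM // !dvdn_prime2 // negb_or => /andP[r3 rq].
have q3 : q != 3 by rewrite gtn_eqF // ltnW.
have qm3 := prime_mod3 q_prime q3.
apply: flat_invCyclotomic3qr => //.
have [le_r|lt_r] := leqP (2 * q - 1) r.
  by move=> k; apply: Psi3qr_coef_le.
apply: Psi3qr_coef_le_check => //.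
have: all (fun q => all (fun r => all (fun k => `|Psi3qr_coef q r k| <= 1)
        (iota 0 (q * r + 2 * r + 2 * q)))
      [seq r <- iota 0 (2 * q - 1) | [&& prime r, r != 3 & r != q]]) [:: 5; 7]%N.
  by vm_compute.
by move=> /allP/(_ q q57)/allP; apply; rewrite mem_filter r_prime r3 rq mem_iota.
Qed.

Lemma not_flat_invCyclotomic3qr q r : prime q -> prime r -> (3 < q)%N ->
  (q < r <= 2 * q - 3)%N -> (r %% 3 = q %% 3)%N -> ~ flat 'Psi_(3 * q * r).
Proof.
move=> q_prime r_prime q_gt3 /andP[lt_qr le_r] r_q.
have q3 : (q %% 3 != 0)%N by apply: prime_mod3; rewrite // gtn_eqF.
have qr_large : (r.+1 < q * r)%N by nia.
(* The copies starting at 0 and r overlap here. If q = 1 mod 3, both have value -1 at degree r + 1;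
   if q = 2 mod 3, both have value 1 at degree r. *)
pose k := (if q %% 3 == 1 then r.+1 else r)%N.
apply: (@not_flat_coef _ k); rewrite coef_invCyclotomic3qr //; try lia.
have lt_k : (k < q * r)%N by rewrite /k; case: ifP; lia.
rewrite /Psi3qr_coef /shift_coef; move: (q * r)%N qr_large lt_k => u le_u lt_k.
rewrite !(@ltn_addr k u) // lt_k.
have Phi_high j : (q <= j < 2 * q - 1)%N ->
    Phi3q_coef q j = invPhi3_coef j + invPhi3_coef (j - q).
  by case/andP=> le_qj lt_j; rewrite /Phi3q_coef /shift_coef lt_j ltnNge le_qj.
have Phi1 : Phi3q_coef q 1 = -1 by rewrite /Phi3q_coef /shift_coef !ifT //; lia.
have Phi0 : Phi3q_coef q 0 = 1 by apply: Phi3q_coef0; lia.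
rewrite ltn0 subn0 /k; case: (boolP (q %% 3 == 1)%N) => q1.
  rewrite (_ : r.+1 < r = false)%N; last by lia.
  rewrite (_ : r.+1 < 2 * r)%N; last by lia.
  by rewrite subSnn Phi1 Phi_high /invPhi3_coef; lia.
rewrite ltnn subnn (_ : r < 2 * r)%N; last by lia.
by rewrite Phi0 Phi_high /invPhi3_coef; lia.
Qed.

Lemma coef_invCyclotomic3qr_small q r k :
  prime q -> prime r -> (3 < q < r)%N -> (k <= 16)%N ->
  `|('Psi_(3 * q * r))`_k| <= 1.
Proof.
move=> q_prime r_prime /andP[q_gt3 lt_qr] k_le.
rewrite coef_invCyclotomic3qr //; try lia.
(* Once r >= 17, every shifted copy starts above degree 16. *)
have [lt_r|le_r] := ltnP r 17.
  have: all (fun r => all (fun q =>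
      all (fun k => `|Psi3qr_coef q r k| <= 1) (iota 0 17))
      [seq q <- iota 4 (r - 4) | prime q]) [seq r <- iota 0 17 | prime r].
    by vm_compute.
  move/allP/(_ r); rewrite mem_filter r_prime mem_iota => /(_ lt_r).
  move/allP/(_ q); rewrite mem_filter q_prime mem_iota.
  rewrite (_ : 4 <= q < _)%N; last by lia.
  by move=> /(_ isT)/allP; apply; rewrite mem_iota.
have le_qr : (r <= q * r)%N by rewrite leq_pmull //; lia.
rewrite /Psi3qr_coef /shift_coef (_ : k < q * r)%N; last by lia.
rewrite (_ : k < q * r + r)%N; last by lia.
rewrite (_ : k < q * r + 2 * r)%N; last by lia.
rewrite (_ : k < r)%N; last by lia.
rewrite (_ : k < 2 * r)%N; last by lia.
rewrite !addr0 sub0r normrN subn0.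
by apply: Phi3q_coef_bound; apply: prime_mod3; rewrite // gtn_eqF.
Qed.

Theorem theorem6 :
  (forall r : nat, prime r -> flat 'Psi_(15 * r) /\ flat 'Psi_(21 * r)) /\
  (forall q : nat, prime q -> (11 <= q)%N ->
     (forall r : nat, prime r -> (2 * q - 1 <= r)%N -> flat 'Psi_(3 * q * r)) /\
     (exists r : nat, prime r /\ ~ flat 'Psi_(3 * q * r))) /\
  (forall q r : nat, prime q -> prime r -> (3 < q)%N -> (q < r)%N ->
     forall k : nat, (k <= 16)%N -> `|('Psi_(3 * q * r))`_k| <= 1).
Proof.
split; last split.
- move=> r r_prime; rewrite -[15%N]/(3 * 5)%N -[21%N]/(3 * 7)%N.
  by split; apply: flat_invCyclotomic3q_5_7.
- move=> q q_prime q_ge; split.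
    move=> r r_prime le_r; apply: flat_invCyclotomic3qr => //; try lia.
    by move=> k; apply: Psi3qr_coef_le; rewrite ?prime_mod3 //; lia.
  have [r [r_prime r_q lt_qr le_r]] := prime_class_next q_prime q_ge.
  exists r; split=> //; apply: not_flat_invCyclotomic3qr => //; lia.
move=> q r q_prime r_prime q_gt3 lt_qr k.
by apply: coef_invCyclotomic3qr_small => //; lia.
Qed.
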